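(* Let $p$ be an odd prime and let $G$ be a group with $|G|=p^n$ and $|Z(G)|=p^{n-2}$. Then the metric dimension of the commuting graph $\Gamma=\zeta(G,G)$ is $p^n-(p+2)$.
   Context: $Z(G)$ is the center of $G$. The commuting graph $\zeta(G,G)$ is the simple graph with vertex set $G$ in which two distinct vertices are adjacent if and only if they commute in $G$. For a connected graph $\Gamma$ with vertex set $V$, let $d(u,v)$ be the length of a shortest path between $u$ and $v$. A subset $S\subseteq V$ is a resolving set of $\Gamma$ if for every pair of distinct vertices $u,v\in V$ there is $w\in S$ with $d(u,w)\neq d(v,w)$. The metric dimension $\beta(\Gamma)$ is the minimum cardinality of a resolving set. *)

(* Defs.v *)
From HB Require Import structures.
From mathcomp Require Import all_boot all_fingroup all_solvable.

Set Implicit Arguments.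
Unset Strict Implicit.
Unset Printing Implicit Defensive.

Record sgraph := SGraph {
  vertex :> finType;
  adj : rel vertex;
  adj_sym : symmetric adj;
  adj_irrefl : irreflexive adj
}.

Definition connected_graph (g : sgraph) : Prop :=
  forall u v : g, connect (@adj g) u v.

(* A path from u is encoded, as in path.v, by the list of its vertices after  *)
(* u, so its length (number of edges) is the size of that list.               *)
Definition has_path_of_length (g : sgraph) (u v : g) (k : nat) : bool :=
  [exists t : k.-tuple g, path (@adj g) u t && (last u t == v)].

(* A shortest path has fewer than #|g| edges; gdist takes the junk value #|g| *)
(* only when v is not reachable from u (see gdist_attained).                  *)
Definition gdist (g : sgraph) (u v : g) : nat :=
  \big[minn/#|g|]_(k < #|g| | has_path_of_length u v k) k.

Definition resolving (g : sgraph) (S : {set g}) : bool :=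
  [forall u : g, forall v : g,
     (u != v) ==> [exists w in S, gdist u w != gdist v w]].

(* The default value #|g| is harmless: the full vertex set is resolving (see  *)
(* resolvingT), so this is the minimum over a nonempty family.                *)
Definition metric_dim (g : sgraph) : nat :=
  \big[minn/#|g|]_(S : {set g} | resolving S) #|S|.

Section CommutingGraph.
Variables (gT : finGroupType) (G : {group gT}).
Local Open Scope group_scope.

Definition commuting_adj : rel (subg_of G) :=
  fun x y => (x != y) && (sgval x * sgval y == sgval y * sgval x).

Lemma commuting_adj_sym : symmetric commuting_adj.
Proof. by move=> x y; rewrite /commuting_adj eq_sym [X in _ && X]eq_sym. Qed.

Lemma commuting_adj_irrefl : irreflexive commuting_adj.
Proof. by move=> x; rewrite /commuting_adj eqxx. Qed.

Definition commuting_graph : sgraph :=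
  SGraph commuting_adj_sym commuting_adj_irrefl.

Lemma commuting_graph_connected : connected_graph commuting_graph.
Proof.
have c1 (x : commuting_graph) :
    connect (@adj commuting_graph) x (1 : subg_of G).
  have [->|nx1] := eqVneq x (1 : subg_of G); first exact: connect0.
  by apply: connect1; rewrite /= /commuting_adj nx1 /= mulg1 mul1g.
move=> u v; apply: connect_trans (c1 u) _.
by rewrite (sym_connect_sym commuting_adj_sym); exact: c1.
Qed.

End CommutingGraph.

Lemma has_path_of_lengthP (g : sgraph) (u v : g) (k : nat) :
  reflect (exists s : seq g, [/\ path (@adj g) u s, last u s = v & size s = k])
          (has_path_of_length u v k).
Proof.
apply: (iffP existsP) => [[t /andP[pt /eqP lt]] | [s [ps ls sz]]].
  by exists t; rewrite size_tuple.
have st : size s == k by apply/eqP.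
by exists (Tuple st); rewrite /= ps ls eqxx.
Qed.

Lemma bigminn_le (I : finType) (P : pred I) (F : I -> nat) (m : nat) (i : I) :
  P i -> \big[minn/m]_(j | P j) F j <= F i.
Proof.
move=> Pi; rewrite unlock; have := mem_index_enum i.
elim: (index_enum I) => //= j r IHr; rewrite inE => /predU1P[<-|/IHr le_r].
  by rewrite Pi geq_minl.
by case: ifP => // _; exact: leq_trans (geq_minr _ _) le_r.
Qed.

Lemma bigminn_attained (I : finType) (P : pred I) (F : I -> nat) (m : nat)
    (i : I) :
  P i -> F i <= m -> exists2 j, P j & \big[minn/m]_(j | P j) F j = F j.
Proof.
move=> Pi Fim.
suff [//|E] : (exists2 j, P j & \big[minn/m]_(j | P j) F j = F j)
    \/ \big[minn/m]_(j | P j) F j = m.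
  exists i => //; apply/eqP; rewrite eqn_leq bigminn_le //=.
  by rewrite E.
pose K x := (exists2 j, P j & x = F j) \/ x = m.
apply: (big_ind K); first by right.
  by move=> x y Kx Ky; rewrite /minn; case: ifP.
by move=> j Pj; left; exists j.
Qed.

Lemma gdist_le (g : sgraph) (u v : g) (s : seq g) :
  path (@adj g) u s -> last u s = v -> gdist u v <= size s.
Proof.
move=> ps ls; case/shortenP: ps ls => s' ps' us' sub ls.
have lt_s' : size s' < #|g|.
  by have := max_card (mem (u :: s')); rewrite (card_uniqP us').
have le_s' : size s' <= size s.
  by apply: uniq_leq_size => [|x /sub //]; case/andP: us'.
apply: leq_trans le_s'.
have h : has_path_of_length u v (Ordinal lt_s').
  by apply/has_path_of_lengthP; exists s'.
rewrite /gdist.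
exact: (bigminn_le (P := fun k : 'I_#|g| => has_path_of_length u v k)
                   (@nat_of_ord #|g|) #|g| h).
Qed.

Lemma gdist_attained (g : sgraph) (u v : g) :
  connect (@adj g) u v ->
  exists s : seq g, [/\ path (@adj g) u s, last u s = v & size s = gdist u v].
Proof.
case/connectP=> s /shortenP[s' ps' us' _] lv.
have lt_s' : size s' < #|g|.
  by have := max_card (mem (u :: s')); rewrite (card_uniqP us').
have h : has_path_of_length u v (Ordinal lt_s').
  by apply/has_path_of_lengthP; exists s'.
have [k /has_path_of_lengthP[t [pt lt sz]] E] :=
  bigminn_attained (P := fun k : 'I_#|g| => has_path_of_length u v k)
    (F := @nat_of_ord #|g|)
    h (ltnW lt_s').
by exists t; split=> //; rewrite sz -E.
Qed.

Lemma gdistxx (g : sgraph) (u : g) : gdist u u = 0.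
Proof. by apply/eqP; rewrite -leqn0 (gdist_le (s := [::])). Qed.

Lemma resolvingT (g : sgraph) (g_conn : connected_graph g) :
  resolving [set: g].
Proof.
apply/forallP=> u; apply/forallP=> v; apply/implyP=> neq_uv.
apply/existsP; exists u; rewrite inE gdistxx eq_sym.
have [[|x s] [_ /= lu sz]] := gdist_attained (g_conn v u).
  by rewrite lu eqxx in neq_uv.
by rewrite -sz.
Qed.

Lemma metric_dim_le (g : sgraph) (S : {set g}) :
  resolving S -> metric_dim g <= #|S|.
Proof. exact: bigminn_le. Qed.

Lemma metric_dim_attained (g : sgraph) :
  connected_graph g ->
  exists2 S : {set g}, resolving S & #|S| = metric_dim g.
Proof.
move=> /resolvingT rT.
have [S rS E] := bigminn_attained (F := fun S : {set g} => #|S|)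
  rT (max_card [set: g]).
by exists S.
Qed.

(* Main.v *)
(** Since the quotient by the center has order p^2, the centralizer of every
    non-central x is abelian of order p^(n-1), and C(y) = C(x) exactly for the
    non-central y in C(x).  Counting the elements of G by their centralizers
    shows that there are p + 2 distinct ones, one of them (G itself) coming from
    the center.  Elements with the same centralizer are twins in the commuting
    graph, so a resolving set omits at most one element of each such class.
    Conversely the complement of a transversal of the classes is resolving: let
    u and v be omitted with u non-central.  If v is non-central, u^-1 separates
    them, being a twin of u distinct from u because |G| is odd; if v is central,
    they are separated by an element that does not commute with u, or by its
    inverse. *)

Require Import Defs.
From mathcomp Require Import all_boot all_fingroup all_solvable.
From mathcomp Require Import zify.

Set Implicit Arguments.
Unset Strict Implicit.
Unset Printing Implicit Defensive.

(** [pick] depends only on the fibre of [f], so the points that it selects from their own fibre form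
    a transversal. *)
Lemma exists_transversal_of_fun (A B : finType) (f : A -> B) :
  exists2 X : {set A}, {in X &, injective f} & #|X| = #|f @: [set: A]|.
Proof.
pose X := [set x | [pick y | f y == f x] == Some x].
have injX : {in X &, injective f}.
  move=> x y; rewrite !inE => /eqP xX /eqP yX fxy.
  by move: xX; rewrite fxy yX => -[].
exists X => //; rewrite -(card_in_imset injX); congr #|pred_of_set _|.
apply/setP=> b; apply/imsetP/imsetP=> [[x _ ->]|[x _ ->]]; first by exists x.
have [y pick_y] : exists y, [pick y | f y == f x] = Some y.
  by case: pickP => [y _|/(_ x)]; [exists y | rewrite eqxx].
have fyx : f y = f x by move: pick_y; case: pickP => // z /eqP fz [<-].
by exists y => //; rewrite inE fyx pick_y.
Qed.

(** * Centralizers of elements, and how many there are *)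

Section Centralizers.

Local Open Scope group_scope.

Variables (gT : finGroupType) (G : {group gT}).
Implicit Types x y : gT.

Lemma subcent1_center x : x \in G -> ('C_G[x] == G) = (x \in 'Z(G)).
Proof.
move=> Gx; rewrite in_setI Gx /= -sub_cent1; exact: (sameP eqP setIidPl).
Qed.

Lemma subcent1V x : 'C_G[x^-1] = 'C_G[x].
Proof. by apply/setP=> y; rewrite !in_setI cent1C groupV cent1C. Qed.

Lemma center_sub_subcent1 x : x \in G -> 'Z(G) \subset 'C_G[x].
Proof. by move=> Gx; rewrite setIS // -cent_set1 centS ?sub1set. Qed.

Lemma odd_noncentral_neqV x :
  odd #|G| -> x \in G -> x \notin 'Z(G) -> x^-1 != x.
Proof.
move=> oddG Gx; apply: contra => /eqP xV.
suff -> : x = 1 by apply: group1.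
apply/eqP; rewrite -order_eq1 -dvdn1.
have /eqP <- : coprime 2 #|G| by rewrite coprime2n.
by rewrite dvdn_gcd order_dvdG // order_dvdn expgS expg1 -{1}xV mulVg eqxx.
Qed.

Variables (p m : nat).
Hypotheses (p_pr : prime p) (cardG : #|G| = (p ^ m.+2)%N)
  (cardZ : #|'Z(G)| = (p ^ m)%N).

(** The order is a power of p, and C(x) lies strictly between Z(G), which misses x, and G. *)
Lemma card_subcent1 x : x \in G -> x \notin 'Z(G) -> #|'C_G[x]| = (p ^ m.+1)%N.
Proof.
move=> Gx nZx; have p_gt1 := prime_gt1 p_pr.
have /dvdn_pfactor : #|'C_G[x]| %| p ^ m.+2 by rewrite -cardG cardSg ?subsetIl.
case=> // k _ cardC.
have : 'Z(G) \proper 'C_G[x].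
  apply/properP; split; first exact: center_sub_subcent1.
  by exists x => //; rewrite inE Gx cent1id.
have : 'C_G[x] \proper G by rewrite properEneq subsetIl subcent1_center ?nZx.
move=> /proper_card + /proper_card.
rewrite cardC cardG cardZ !ltn_exp2l // => k_lt k_gt.
by congr (p ^ _)%N; lia.
Qed.

Lemma abelian_subcent1 x : x \in G -> x \notin 'Z(G) -> abelian 'C_G[x].
Proof.
move=> Gx nZx; have p_gt1 := prime_gt1 p_pr.
have cardC := card_subcent1 Gx nZx.
have /dvdn_pfactor : #|'Z('C_G[x])| %| p ^ m.+1.
  by rewrite -cardC cardSg ?subsetIl.
case=> // k k_le cardZC.
(* The centre of C(x) contains Z(G) and also x, which leaves it no order below p^(m+1). *)
have Z_prop : 'Z(G) \proper 'Z('C_G[x]).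
  apply/properP; split; last first.
    exists x => //; rewrite 2!inE Gx cent1id /=.
    by rewrite -sub_cent1 subsetIr.
  rewrite subsetI center_sub_subcent1 //=.
  by rewrite (subset_trans (subsetIr G 'C(G))) // centS ?subsetIl.
have := proper_card Z_prop; rewrite cardZ cardZC ltn_exp2l // => k_gt.
apply/center_idP/eqP; rewrite eqEcard subsetIl cardC cardZC.
by rewrite leq_exp2l.
Qed.

Lemma eq_subcent1 x y : x \in G -> x \notin 'Z(G) -> y \in G ->
  ('C_G[y] == 'C_G[x]) = (y \in 'C_G[x] :\: 'Z(G)).
Proof.
move=> Gx nZx Gy; rewrite in_setD; apply/eqP/andP => [Cyx|[nZy Cxy]].
  by rewrite -subcent1_center // Cyx subcent1_center // nZx -Cyx
             in_setI Gy cent1id.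
apply/eqP; rewrite eq_sym eqEcard !card_subcent1 // leqnn andbT.
rewrite subsetI subsetIl sub_cent1.
by apply: subsetP Cxy; apply: abelian_subcent1.
Qed.

(** The map sending x to C(x) has fibre Z(G) over G, and over any other centralizer C the fibre is C
    minus Z(G), of size p^(m+1) - p^m. The fibre sizes sum to |G|. *)
Lemma card_subcent1_imset : #|[set 'C_G[x] | x in G]| = (p + 2)%N.
Proof.
have p_gt1 := prime_gt1 p_pr.
set I := [set _ | _ in _].
have GI : gval G \in I.
  apply/imsetP; exists 1 => //; apply/esym/eqP.
  by rewrite subcent1_center ?group1.
have : #|G| = \sum_(C in I) #|[set x in G | 'C_G[x] == C]|.
  rewrite -sum1_card (partition_big (fun x => 'C_G[x]) (mem I)) /=.
    by apply: eq_bigr => C _; rewrite -sum1dep_card.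
  by move=> x Gx; apply: imset_f.
rewrite (bigD1 (gval G)) //=.
rewrite (_ : [set x in G | 'C_G[x] == G] = 'Z(G)); last first.
  apply/setP=> x; rewrite inE; case Gx: (x \in G) => /=.
    exact: subcent1_center.
  by rewrite inE Gx.
rewrite (eq_bigr (fun=> (p ^ m.+1 - p ^ m)%N)); last first.
  move=> C /andP[/imsetP[x Gx ->]]; rewrite subcent1_center // => nZx.
  rewrite -cardZ -(card_subcent1 Gx nZx).
  rewrite -(setIidPr (center_sub_subcent1 Gx)) -cardsD.
  congr #|pred_of_set _|; apply/setP=> y; rewrite inE.
  have [Gy|nGy] := boolP (y \in G); first exact: eq_subcent1.
  by rewrite !inE (negPf nGy) !andbF.
rewrite sum_nat_const cardG cardZ (cardD1 (gval G) (mem I)) GI /=.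
rewrite (@eq_card _ [predD1 I & gval G]
                    [pred C | (C \in I) && (C != G)]); last first.
  by move=> C; rewrite !inE andbC.
(* [k] counts the centralizers other than [G]. Dividing by p^m leaves p^2 = 1 + k(p - 1), so k = p +
   1. *)
move: #|_| => k.
have pm_gt0 : 0 < p ^ m by rewrite expn_gt0 prime_gt0.
rewrite !expnS; move: (p ^ m)%N pm_gt0 => q q_gt0 E.
have {}E : (q * (p * p) = q * (1 + k * (p - 1)))%N by nia.
have /eqP := E; rewrite eqn_pmul2l // => /eqP {}E.
suff : k = p.+1 by lia.
have : ((p - 1) * k = (p - 1) * p.+1)%N by nia.
by move/eqP; rewrite eqn_pmul2l ?subn_gt0 // => /eqP.
Qed.

End Centralizers.

(** * Distances and resolving sets in the commuting graph *)

Section Graph.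

Local Open Scope group_scope.

Variables (gT : finGroupType) (G : {group gT}).
Local Notation Gamma := (commuting_graph G).
Local Notation cent x := 'C_G[sgval x].

Lemma mem_centC (x y : Gamma) : (sgval x \in cent y) = (sgval y \in cent x).
Proof. by rewrite !in_setI !subgP cent1C. Qed.

Lemma gdist_commuting (x y : Gamma) :
  gdist x y = (if x == y then 0 else if sgval x \in cent y then 1 else 2)%N.
Proof.
have adjE (u v : subg_of G) :
    commuting_adj u v = (u != v) && (sgval u \in cent v).
  by rewrite /commuting_adj inE subgP /= cent1E.
have [->|nxy] := eqVneq x y; first exact: gdistxx.
have [s [ps ls sz]] := gdist_attained (commuting_graph_connected x y).
have sz_gt0 : 0 < size s.
  by case: s ls {ps sz} => //= xy; rewrite xy eqxx in nxy.
case: ifPn => [Cxy|nCxy].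
  apply/eqP; rewrite eqn_leq -{2}sz sz_gt0 andbT.
  by rewrite (@gdist_le _ x y [:: y]) //= adjE nxy Cxy.
apply/eqP; rewrite eqn_leq; apply/andP; split; last first.
  rewrite -sz; case: s ps ls {sz sz_gt0} => [|z [|//]] /=.
    by move=> _ xy; rewrite xy eqxx in nxy.
  by rewrite andbT => + zy; rewrite zy adjE (negPf nCxy) andbF.
(* The identity commutes with everything, so it differs from both [x] and [y] and is the midpoint of
   a path of length 2. *)
pose e : Gamma := (1 : subg_of G).
have Ce (z : Gamma) : sgval e \in cent z by rewrite !group1.
have nxe : x != e by apply: contraNneq nCxy => ->.
have ney : e != y by apply: contraNneq nCxy => <-; rewrite mem_centC.
by rewrite (@gdist_le _ x y [:: e; y]) //= !adjE nxe ney Ce mem_centC Ce.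
Qed.

Lemma imset_cent : [set cent x | x in [set: Gamma]] = [set 'C_G[x] | x in G].
Proof.
apply/setP=> C; apply/imsetP/imsetP=> [[x _ ->]|[x Gx ->]].
  by exists (sgval x); rewrite ?subgP.
by exists (subg G x); rewrite ?inE ?subgK.
Qed.

(** A vertex of [S] differs from both [u] and [v], so its distances to them are decided by
    commutation alone. *)
Lemma resolving_inj_cent (S : {set Gamma}) :
  resolving S -> {in ~: S &, injective (fun x : Gamma => cent x)}.
Proof.
move=> resS u v; rewrite !inE => nSu nSv Cuv; apply/eqP; apply: contraT => nuv.
have /forallP/(_ v)/implyP/(_ nuv)/existsP[w /andP[Sw]] := forallP resS u.
rewrite !gdist_commuting ![sgval _ \in cent w]mem_centC Cuv.
have /negPf-> : u != w by apply: contraNneq nSu => ->.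
have /negPf-> : v != w by apply: contraNneq nSv => ->.
by rewrite eqxx.
Qed.

(** The second hypothesis is the conclusion of [eq_subcent1]; it and oddness carry all that is used
    about the order of G and its centre. *)
Lemma inj_cent_resolving (S : {set Gamma}) : odd #|G| ->
  (forall x y, x \in G -> x \notin 'Z(G) -> y \in G ->
     ('C_G[y] == 'C_G[x]) = (y \in 'C_G[x] :\: 'Z(G))) ->
  {in ~: S &, injective (fun x : Gamma => cent x)} -> resolving S.
Proof.
move=> oddG eqC injS.
have outS (x y : Gamma) : x \notin S -> x != y -> cent x = cent y -> y \in S.
  move=> nSx nxy Cxy; apply: contraR nxy => nSy.
  by apply/eqP; apply: injS; rewrite ?inE.
(* Since [w] and its inverse are distinct with the same centralizer, at least one of them lies in
   [S]. *)
have reprS (w : Gamma) : sgval w \notin 'Z(G) ->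
    exists2 w', w' \in S & cent w' = cent w.
  move=> nZw; have [Sw|nSw] := boolP (w \in S); first by exists w.
  have CwV : cent (w^-1 : subg_of G) = cent w by rewrite /= subcent1V.
  exists (w^-1 : subg_of G) => //; apply: (outS w) => //.
  by rewrite eq_sym -val_eqE /= (odd_noncentral_neqV oddG) ?subgP.
pose sep (u v : Gamma) := [exists w in S, gdist u w != gdist v w].
have sepC u v : sep u v = sep v u.
  by apply: eq_existsb => w; rewrite eq_sym.
have sepS u v : u \in S -> u != v -> sep u v.
  move=> Su nuv; apply/existsP; exists u; rewrite Su !gdist_commuting eqxx.
  by rewrite [v == u]eq_sym (negPf nuv); case: ifP.
have sep_noncentral u v : u \notin S -> v \notin S -> u != v ->
    sgval u \notin 'Z(G) -> sep u v.
  move=> nSu nSv nuv nZu.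
  suff [w [Sw Cw]] : exists w : Gamma, w \in S /\
      (sgval u \in cent w) != (sgval v \in cent w).
    apply/existsP; exists w; rewrite Sw !gdist_commuting.
    have /negPf-> : u != w by apply: contraNneq nSu => ->.
    have /negPf-> : v != w by apply: contraNneq nSv => ->.
    by case: (sgval u \in _) Cw; case: (sgval v \in _).
  have [Zv|nZv] := boolP (sgval v \in 'Z(G)).
    have : ~~ (G \subset 'C_G[sgval u]).
      by rewrite subsetI subxx /= sub_cent1; move: nZu; rewrite in_setI subgP.
    case/subsetPn=> w0 Gw0 nCw0; pose w : Gamma := subg G w0.
    have [|w' Sw' Cw'] := reprS w.
      apply: contra nCw0; rewrite /= subgK // => /setIP[_ /centP cw].
      by rewrite in_setI Gw0 cent1E (cw _ (subgP u)) eqxx.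
    exists w'; split=> //; rewrite Cw' ![sgval _ \in cent w]mem_centC.
    rewrite /= subgK // (negPf nCw0) (eqP (_ : 'C_G[sgval v] == G)) ?Gw0 //.
    by rewrite subcent1_center ?subgP.
  (* [u] commutes with [u']; were [v] to do so as well, it would share the centralizer of [u] and
     hence lie in [S]. *)
  have [u' Su' Cu'] := reprS u nZu.
  exists u'; split=> //; rewrite Cu' in_setI subgP cent1id /= eq_sym.
  rewrite eqb_id; apply: contra nSv => Cvu; apply: (outS u) => //.
  by apply/esym/eqP; rewrite eqC ?subgP // in_setD nZv.
apply/forallP=> u; apply/forallP=> v; apply/implyP=> nuv; rewrite -/(sep u v).
have [Su|nSu] := boolP (u \in S); first exact: sepS.
have [Sv|nSv] := boolP (v \in S); first by rewrite sepC sepS // eq_sym.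
have [Zu|] := boolP (sgval u \in 'Z(G)); last exact: sep_noncentral.
rewrite sepC; apply: sep_noncentral => //; first by rewrite eq_sym.
(* Central elements all have centralizer [G], so at most one is outside [S]. *)
apply: contra nSv => Zv; apply: (outS u) => //.
have := subcent1_center (subgP u); have := subcent1_center (subgP v).
by rewrite Zu Zv => /eqP-> /eqP->.
Qed.

End Graph.

Theorem theorem5p2 (gT : finGroupType) (G : {group gT}) (p n : nat) :
  prime p -> odd p ->
  2 <= n ->
  #|G| = p ^ n ->
  #|'Z(G)%g| = p ^ (n - 2) ->
  metric_dim (commuting_graph G) = p ^ n - (p + 2).
Proof.
move=> p_pr p_odd n_ge2 cardG cardZ.
have cardG' : #|G| = (p ^ (n - 2).+2)%N by rewrite cardG -addn2 subnK.
have cardI := card_subcent1_imset p_pr cardG' cardZ.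
have cardV : #|commuting_graph G| = (p ^ n)%N.
  by rewrite -cardG (card_isog (isog_subg G)) cardsT.
have cardSC (S : {set commuting_graph G}) : (#|S| + #|~: S| = p ^ n)%N.
  by rewrite cardsC cardV.
have [X injX cardX] :=
  exists_transversal_of_fun (fun x : commuting_graph G => 'C_G[sgval x]%g).
move: cardX; rewrite imset_cent cardI => cardX.
apply/eqP; rewrite eqn_leq; apply/andP; split.
  have /metric_dim_le : resolving (~: X).
    apply: inj_cent_resolving; rewrite ?setCK //.
      by rewrite cardG oddX p_odd orbT.
    exact: eq_subcent1 p_pr cardG' cardZ.
  (* The sum in [cardSC] also gives p + 2 <= p^n, so the truncated subtraction is exact. *)
  by have := cardSC X; lia.
have [S /resolving_inj_cent injS <-] :=
  metric_dim_attained (@commuting_graph_connected _ G).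
have : #|~: S| <= p + 2.
  by rewrite -cardI -imset_cent -(card_in_imset injS) subset_leq_card //
             imsetS ?subsetT.
by have := cardSC S; lia.
Qed.
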